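(* Let $\mathcal{C}\subset\mathbb{R}^n$ be a closed convex cone, let $L=\mathcal{C}\cap(-\mathcal{C})$, let $L^\perp$ be the orthogonal complement of $L$ in $\mathbb{R}^n$, and let $K=\mathcal{C}\cap L^\perp$, so that $\mathcal{C}=K\oplus L$ (orthogonal sum). Then $\mathcal{C}$ is an isotone projection cone (in $\mathbb{R}^n$) if and only if the pointed cone $K\subset L^\perp$ is an isotone projection cone in $L^\perp$.
   Context: $\mathbb{R}^n$ carries the Euclidean inner product and norm, and its subspaces the induced ones. A closed convex cone in a finite-dimensional Euclidean space $E$ is a closed nonempty set $\mathcal{C}\subset E$ with $\mathcal{C}+\mathcal{C}\subset\mathcal{C}$ and $t\mathcal{C}\subset\mathcal{C}$ for all $t\ge 0$; it is pointed if $\mathcal{C}\cap(-\mathcal{C})=\{0\}$. For a nonempty closed convex set $\mathcal{C}\subset E$, $P_{\mathcal{C}}:E\to\mathcal{C}$ denotes the metric projection, i.e. $P_{\mathcal{C}}x$ is the unique point of $\mathcal{C}$ nearest to $x$. For a closed convex cone $\mathcal{C}\subset E$, write $u\le_{\mathcal{C}}v$ when $v-u\in\mathcal{C}$. The cone $\mathcal{C}$ is an isotone projection cone in $E$ if for all $u,v\in E$, $u\le_{\mathcal{C}}v$ implies $P_{\mathcal{C}}u\le_{\mathcal{C}}P_{\mathcal{C}}v$. ''$K$ is an isotone projection cone in $L^\perp$'' means this with $E=L^\perp$. *)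

(* Defs.v *)
From HB Require Import structures.
From mathcomp Require Import all_boot all_order all_algebra.
From mathcomp Require Import all_classical all_reals all_analysis.
Set Implicit Arguments.
Unset Strict Implicit.
Unset Printing Implicit Defensive.
Import Order.TTheory GRing.Theory Num.Theory.
Import numFieldNormedType.Exports.
Local Open Scope classical_set_scope.
Local Open Scope ring_scope.

Definition dot (R : realType) (n : nat) (u v : 'rV[R]_n) : R :=
  \sum_(i < n) u ord0 i * v ord0 i.

(* The library norm `|u| on row vectors is the sup norm; its topology, used by
   [closed] below, is the Euclidean one. *)
Definition enorm (R : realType) (n : nat) (u : 'rV[R]_n) : R :=
  Num.sqrt (dot u u).

Definition orthocompl (R : realType) (n : nat) (A : set 'rV[R]_n) :
    set 'rV[R]_n :=
  [set u | forall a, A a -> dot u a = 0].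

(* The ambient space E is a linear subspace of R^n, represented by its underlying
   set ([setT] for R^n itself).  As E is closed in R^n, a subset of E is closed
   in E iff it is closed in R^n. *)
Definition closed_convex_cone (R : realType) (n : nat) (E C : set 'rV[R]_n) :
    Prop :=
  [/\ C `<=` E,
      closed C,
      C !=set0,
      (forall u v, C u -> C v -> C (u + v)) &
      (forall (t : R) u, 0 <= t -> C u -> C (t *: u))].

Definition lineality (R : realType) (n : nat) (C : set 'rV[R]_n) :
    set 'rV[R]_n :=
  C `&` [set - x | x in C].

Definition pointed (R : realType) (n : nat) (C : set 'rV[R]_n) : Prop :=
  lineality C = [set 0].

Definition nearest (R : realType) (n : nat) (C : set 'rV[R]_n)
    (x p : 'rV[R]_n) : Prop :=
  C p /\ forall q, C q -> enorm (x - p) <= enorm (x - q).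

(* When C is nonempty, closed and convex, exactly one p satisfies [nearest C x p];
   the default value 0 of [xget] is only returned when there is none. *)
Definition proj (R : realType) (n : nat) (C : set 'rV[R]_n) (x : 'rV[R]_n) :
    'rV[R]_n :=
  xget 0 (nearest C x).

Definition cone_le (R : realType) (n : nat) (C : set 'rV[R]_n)
    (u v : 'rV[R]_n) : Prop :=
  C (v - u).

Definition isotone_projection_cone (R : realType) (n : nat)
    (E C : set 'rV[R]_n) : Prop :=
  closed_convex_cone E C /\
  forall u v, E u -> E v -> cone_le C u v -> cone_le C (proj C u) (proj C v).

Definition orthogonal_sum (R : realType) (n : nat) (C A B : set 'rV[R]_n) :
    Prop :=
  (forall a b, A a -> B b -> dot a b = 0) /\
  C = [set a + b | a in A & b in B].

(* Main.v *)
Require Import Defs.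
From HB Require Import structures.
From mathcomp Require Import all_boot all_order all_algebra.
From mathcomp Require Import all_classical all_reals all_analysis.
From mathcomp Require Import ring lra.
Import Order.TTheory GRing.Theory Num.Theory.
Import numFieldNormedType.Exports.
Local Open Scope classical_set_scope.
Local Open Scope ring_scope.

(** Write every vector as [y + l] with [l] in [L] and [y] orthogonal to [L];
    this is possible because [L] is a closed linear subspace, so that [y] is
    what remains after subtracting a nearest point of [L].  Since [C] contains
    [L] and [- L], removing the [L]-component of a point of [C] leaves a point
    of [C]: hence [C] is the orthogonal sum of [K] and [L].

    By Pythagoras, the squared distance from [y + l] to a point [q + m] of
    [C = K + L] is the sum of the squared distances from [y] to [q] and from
    [l] to [m].  Minimizing it over [K] and [L] separately gives the formula
    that carries the proof ([proj_orthogonal_translate]):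
    [P_C (y + l) = P_K y + l].

    Both implications are read off from it.  On vectors orthogonal to [L] the
    two projections agree, and the difference of two points of [K] is
    orthogonal to [L], so it lies in [K] as soon as it lies in [C].
    Conversely, two vectors are ordered by [C] exactly when their components
    orthogonal to [L] are ordered by [K], and the [L]-components added back
    by the formula differ by an element of [L], which [C] absorbs. *)

(** * The Euclidean inner product *)

Lemma dotC {R : realType} {n : nat} (u v : 'rV[R]_n) : dot u v = dot v u.
Proof. by apply: eq_bigr => i _; rewrite mulrC. Qed.

Lemma dotDl {R : realType} {n : nat} (u v w : 'rV[R]_n) :
  dot (u + v) w = dot u w + dot v w.
Proof. by rewrite /dot -big_split; apply: eq_bigr => i _; rewrite !mxE mulrDl. Qed.

Lemma dotZl {R : realType} {n : nat} (t : R) (u w : 'rV[R]_n) :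
  dot (t *: u) w = t * dot u w.
Proof. by rewrite /dot mulr_sumr; apply: eq_bigr => i _; rewrite !mxE mulrA. Qed.

Lemma dotNl {R : realType} {n : nat} (u w : 'rV[R]_n) : dot (- u) w = - dot u w.
Proof. by rewrite -scaleN1r dotZl mulN1r. Qed.

Lemma dotDr {R : realType} {n : nat} (u v w : 'rV[R]_n) :
  dot w (u + v) = dot w u + dot w v.
Proof. by rewrite dotC dotDl !(dotC w). Qed.

Lemma dotZr {R : realType} {n : nat} (t : R) (u w : 'rV[R]_n) :
  dot w (t *: u) = t * dot w u.
Proof. by rewrite dotC dotZl dotC. Qed.

Lemma dotNr {R : realType} {n : nat} (u w : 'rV[R]_n) : dot w (- u) = - dot w u.
Proof. by rewrite dotC dotNl dotC. Qed.

Lemma dot0l {R : realType} {n : nat} (w : 'rV[R]_n) : dot 0 w = 0.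
Proof. by rewrite -(scale0r w) dotZl mul0r. Qed.

Definition dotE := (@dotDl, @dotDr, @dotNl, @dotNr, @dotZl, @dotZr).

Lemma sqr_coord_le_dot {R : realType} {n : nat} (u : 'rV[R]_n) (i : 'I_n) :
  u ord0 i ^+ 2 <= dot u u.
Proof.
rewrite /dot (bigD1 i) //= -expr2 lerDl; apply: sumr_ge0 => j _.
by rewrite -expr2 sqr_ge0.
Qed.

Lemma dot_ge0 {R : realType} {n : nat} (u : 'rV[R]_n) : 0 <= dot u u.
Proof. by apply: sumr_ge0 => j _; rewrite -expr2 sqr_ge0. Qed.

Lemma dot_le0 {R : realType} {n : nat} (u : 'rV[R]_n) : dot u u <= 0 -> u = 0.
Proof.
move=> u0; apply/rowP => i; rewrite mxE; apply/eqP.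
rewrite -sqrf_eq0 eq_le sqr_ge0 andbT.
exact: le_trans (sqr_coord_le_dot u i) u0.
Qed.

Lemma pythagoras {R : realType} {n : nat} (u v : 'rV[R]_n) :
  dot u v = 0 -> dot (u + v) (u + v) = dot u u + dot v v.
Proof. by move=> uv; rewrite !dotE (dotC v) uv; ring. Qed.

Lemma enorm_le {R : realType} {n : nat} (u v : 'rV[R]_n) :
  (enorm u <= enorm v) = (dot u u <= dot v v).
Proof. by rewrite ler_sqrt// dot_ge0. Qed.

Lemma dot_continuous {R : realType} {n : nat} {T : topologicalType}
    (f g : T -> 'rV[R]_n) :
  continuous f -> continuous g -> continuous (fun x => dot (f x) (g x)).
Proof.
move=> cf cg x; apply: cvg_big => [|i _]; first exact: add_continuous.
have coordC (h : T -> 'rV[R]_n) : continuous h ->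
    h y ord0 i @[y --> x] --> h x ord0 i.
  move=> ch; apply: (@continuous_comp _ _ _ h (fun M => M ord0 i)).
    exact: ch.
  exact: coord_continuous.
by apply: cvgM; exact: coordC.
Qed.

(** * Nearest points *)

(** Only the points of [A] in a box around [x] that contains one point of [A]
    compete for the minimal distance, and that part of [A] is compact. *)
Lemma nearest_exists {R : realType} {n : nat} (A : set 'rV[R]_n)
    (x : 'rV[R]_n) :
  closed A -> A !=set0 -> exists p, nearest A x p.
Proof.
move=> clA [a Aa].
pose f (v : 'rV[R]_n) := dot (x - v) (x - v).
pose r := enorm (x - a).
have r2 : r ^+ 2 = f a by rewrite sqr_sqrtr// dot_ge0.
have r0 : 0 <= r by exact: sqrtr_ge0.
pose box (i : 'I_n) : set R := `[x ord0 i - r, x ord0 i + r]%classic.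
pose B := [set v : 'rV[R]_n | forall i, box i (v ord0 i)].
have boxP v : f v <= f a -> B v.
  move=> fva i; rewrite /box/= in_itv/= -ler_distlC -ler_sqr ?nnegrE//.
  rewrite r2 real_normK ?num_real//; apply: le_trans fva.
  by have := sqr_coord_le_dot (x - v) i; rewrite !mxE.
have cB : compact (B `&` A).
  apply: compact_closedI => //; apply: (@rV_compact R n box) => i.
  exact: segment_compact.
have cf : continuous f.
  have cx : continuous (fun v : 'rV[R]_n => x - v).
    move=> v; apply: (@continuousB R 'rV[R]_n _ (fun=> x) id).
      exact: cst_continuous.
    exact: cvg_id.
  exact: dot_continuous.
have BAa : (B `&` A) a by split=> //; exact: boxP.
have [p /set_mem[_ Ap] pmin] := compact_EVT_min (ex_intro _ a BAa) cB
  (continuous_subspaceT cf).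
exists p; split=> // q Aq; rewrite enorm_le -!/(f _).
have [/boxP Bq|/ltW faq] := leP (f q) (f a).
  by apply: pmin; rewrite inE.
by apply: le_trans faq; apply: pmin; rewrite inE.
Qed.

(** By the parallelogram law, the midpoint of two distinct nearest points would
    be strictly nearer. *)
Lemma nearest_unique {R : realType} {n : nat} (A : set 'rV[R]_n)
    (x p q : 'rV[R]_n) :
  (forall u v, A u -> A v -> A (2^-1 *: (u + v))) ->
  nearest A x p -> nearest A x q -> p = q.
Proof.
move=> midA [Ap pmin] [Aq qmin].
have := pmin _ (midA _ _ Ap Aq); have := qmin _ Ap; have := pmin _ Aq.
rewrite !enorm_le => pq qp pm; apply/subr0_eq/dot_le0.
move: pq qp pm; rewrite !dotE !(dotC _ x) (dotC q p); lra.
Qed.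

(** Moving from [p] by a small multiple [t *: a] changes the squared distance by
    [- 2 * t * dot (x - p) a] to first order in [t]. *)
Lemma nearest_subspace_orthogonal {R : realType} {n : nat}
    (L : set 'rV[R]_n) (x p : 'rV[R]_n) :
  (forall u v, L u -> L v -> L (u + v)) ->
  (forall t u, L u -> L (t *: u)) ->
  nearest L x p -> orthocompl L (x - p).
Proof.
move=> LD LZ [Lp pmin] a La.
have {}pmin t : dot (x - p) (x - p) <= dot (x - p - t *: a) (x - p - t *: a).
  by rewrite -enorm_le -(addrA x) -opprD; apply/pmin/LD => //; exact: LZ.
move: (x - p) pmin => y; set s := dot y a; pose A := dot a a => pmin.
have A0 : 0 <= A := dot_ge0 a.
(* The best step is [s / A]; adding 1 to the denominator covers [A = 0] and
   leaves a step short enough for the linear term to dominate. *)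
pose t := s / (A + 1).
have := pmin t; rewrite !dotE (dotC a y) -/s -/A => H.
have st : s = t * (A + 1) by rewrite /t divfK//; apply: lt0r_neq0; lra.
have t2 : t ^+ 2 * (A + 2) <= 0 by move: H; rewrite st; nra.
have t0 : t ^+ 2 <= 0.
  by move: t2; rewrite pmulr_lle0//; lra.
have /eqP : t ^+ 2 = 0 by apply/eqP; rewrite eq_le t0 sqr_ge0.
by rewrite st expf_eq0/= => /eqP ->; rewrite mul0r.
Qed.

Lemma proj_nearest {R : realType} {n : nat} (A : set 'rV[R]_n)
    (x : 'rV[R]_n) :
  closed A -> A !=set0 -> nearest A x (Defs.proj A x).
Proof. by move=> clA A0; apply: xgetPex; exact: nearest_exists. Qed.

Lemma orthocompl_closed {R : realType} {n : nat} (A : set 'rV[R]_n) :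
  closed (orthocompl A).
Proof.
have -> : orthocompl A =
    \bigcap_(a in A) ((fun u => dot u a) @^-1` [set r | r = 0]) by [].
apply: closed_bigI => a _; apply: preimage_closed; last exact: closed_eq.
by move=> u _; apply: dot_continuous => v; [exact: cvg_id|exact: cst_continuous].
Qed.

Lemma orthocomplD {R : realType} {n : nat} (A : set 'rV[R]_n) u v :
  orthocompl A u -> orthocompl A v -> orthocompl A (u + v).
Proof. by move=> Au Av a Aa; rewrite dotDl Au// Av// addr0. Qed.

Lemma orthocomplZ {R : realType} {n : nat} (A : set 'rV[R]_n) (t : R) u :
  orthocompl A u -> orthocompl A (t *: u).
Proof. by move=> Au a Aa; rewrite dotZl Au// mulr0. Qed.

Lemma orthocomplB {R : realType} {n : nat} (A : set 'rV[R]_n) u v :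
  orthocompl A u -> orthocompl A v -> orthocompl A (u - v).
Proof.
by move=> Au Av; rewrite -scaleN1r; apply: orthocomplD => //; exact: orthocomplZ.
Qed.

(** * Splitting a cone along its lineality space *)

Section LinealitySplitting.
Context {R : realType} {n : nat} {C : set 'rV[R]_n}.
Hypothesis hC : closed_convex_cone setT C.

Let L := lineality C.
Let K := C `&` orthocompl L.

Let coneD u v : C u -> C v -> C (u + v).
Proof. by case: hC => _ _ _ + _; exact. Qed.

Let coneZ (t : R) u : 0 <= t -> C u -> C (t *: u).
Proof. by case: hC => _ _ _ _; exact. Qed.

Let cone0 : C 0.
Proof. by case: hC => _ _ [u Cu] _ _; rewrite -(scale0r u); exact: coneZ. Qed.

Lemma linealityP u : L u <-> C u /\ C (- u).
Proof.
split=> [[Cu [v Cv vu]]|]; first by rewrite -{2}vu opprK.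
by case=> Cu CNu; split=> //; exists (- u) => //; rewrite opprK.
Qed.

Lemma linealityD u v : L u -> L v -> L (u + v).
Proof.
by move=> /linealityP[? ?] /linealityP[? ?]; apply/linealityP;
  rewrite opprD; split; exact: coneD.
Qed.

Lemma linealityZ (t : R) u : L u -> L (t *: u).
Proof.
move=> /linealityP[Cu CNu]; apply/linealityP.
have [t0|/ltW t0] := leP 0 t.
  by rewrite -scalerN; split; exact: coneZ.
have Nt0 : 0 <= - t by rewrite oppr_ge0.
by rewrite -scaleNr -[t *: u]opprK -scaleNr -scalerN; split; exact: coneZ.
Qed.

Lemma linealityN u : L u -> L (- u).
Proof. by move=> Lu; rewrite -scaleN1r; exact: linealityZ. Qed.

Lemma lineality0 : L 0.
Proof. by apply/linealityP; rewrite oppr0. Qed.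

Lemma lineality_closed : closed L.
Proof.
have -> : L = C `&` (-%R @^-1` C) by apply/seteqP; split=> u /linealityP.
have clC : closed C by case: hC.
apply: closedI => //; apply: preimage_closed => // u _.
exact: oppr_continuous.
Qed.

Lemma lineality_decomposition x : exists2 l, L l & orthocompl L (x - l).
Proof.
have [l ll] := nearest_exists _ x lineality_closed (ex_intro _ 0 lineality0).
exists l; first by case: ll.
exact: (nearest_subspace_orthogonal _ _ _ linealityD linealityZ).
Qed.

Lemma cone_sub_lineality x l : C x -> L l -> C (x - l).
Proof. by move=> Cx /linealityP[_ CNl]; exact: coneD. Qed.

Lemma cone_decomposition x : C x -> exists2 l, L l & K (x - l).
Proof.
move=> Cx; have [l Ll xl] := lineality_decomposition x.
by exists l => //; split=> //; exact: cone_sub_lineality.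
Qed.

Lemma cone_orthogonal_sum : orthogonal_sum C K L.
Proof.
split; first by move=> a b [_ La]; exact: La.
apply/seteqP; split=> [x Cx|_ [a [Ca _] [b [Cb _] <-]]]; last exact: coneD.
have [l Ll Kxl] := cone_decomposition x Cx.
by exists (x - l) => //; exists l => //; rewrite subrK.
Qed.

Lemma orthogonal_part_cone : closed_convex_cone (orthocompl L) K.
Proof.
have clC : closed C by case: hC.
split.
- by move=> u [].
- by apply: closedI => //; exact: orthocompl_closed.
- by exists 0; split=> // a _; rewrite dot0l.
- by move=> u v [Cu Lu] [Cv Lv]; split; [exact: coneD|exact: orthocomplD].
- by move=> t u t0 [Cu Lu]; split; [exact: coneZ|exact: orthocomplZ].
Qed.

(** A vector of [K] whose opposite is in [K] lies in [L] and is orthogonal to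
    [L], hence to itself. *)
Lemma orthogonal_part_pointed : pointed K.
Proof.
apply/seteqP; split=> [u [[Cu Lu] [v [Cv _] vu]]|_ ->].
  by apply: dot_le0; rewrite Lu//; split=> //; exists v.
have K0 : K 0 by split=> // a _; rewrite dot0l.
by split=> //; exists 0 => //; rewrite oppr0.
Qed.

(** The squared distance from [y + l] to [q] is the sum of the squared
    distances between the components orthogonal to [L] and between those in
    [L]; the choice [Defs.proj K y + l] minimizes the first and cancels the
    second. *)
Lemma proj_orthogonal_translate y l :
  orthocompl L y -> L l -> Defs.proj C (y + l) = Defs.proj K y + l.
Proof.
move=> Ly Ll; have [_ clC C0 _ _] := hC.
have [_ clK K0 _ _] := orthogonal_part_cone.
have [[Ck _] kmin] := proj_nearest _ y clK K0.
apply: (nearest_unique _ _ _ _ _ (proj_nearest _ (y + l) clC C0)).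
  by move=> u v Cu Cv; apply: coneZ; [rewrite invr_ge0|exact: coneD].
split; first by apply: coneD => //; case: Ll.
move=> q Cq; have [m Lm Kqm] := cone_decomposition q Cq.
have -> : y + l - (Defs.proj K y + l) = y - Defs.proj K y.
  by rewrite opprD addrACA subrr addr0.
apply: le_trans (kmin _ Kqm) _; rewrite enorm_le.
have -> : y + l - q = (y - (q - m)) + (l - m).
  by rewrite opprB !addrA; apply/rowP => i; rewrite !mxE; ring.
rewrite [leRHS]pythagoras; first by rewrite lerDl dot_ge0.
apply: (orthocomplB L) => //; first by case: Kqm.
by apply: linealityD => //; exact: linealityN.
Qed.

Lemma isotone_orthogonal_part :
  isotone_projection_cone setT C <-> isotone_projection_cone (orthocompl L) K.
Proof.
have [_ clK K0 _ _] := orthogonal_part_cone.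
split=> -[_ iso].
  split=> [|u v Lu Lv [Cuv _]]; first exact: orthogonal_part_cone.
  have projE y : orthocompl L y -> Defs.proj C y = Defs.proj K y.
    move=> Ly; rewrite -[in LHS](addr0 y) proj_orthogonal_translate ?addr0//.
    exact: lineality0.
  split; first by rewrite -!projE//; exact: iso.
  have Lproj x : orthocompl L (Defs.proj K x).
    by case: (proj_nearest K x clK K0) => -[].
  exact: orthocomplB.
split=> // u v _ _ Cuv.
have [l Ll ul] := lineality_decomposition u.
have [m Lm vm] := lineality_decomposition v.
have Lml : L (m - l) by apply: linealityD => //; exact: linealityN.
rewrite /cone_le -(subrK l u) -(subrK m v) !proj_orthogonal_translate//.
rewrite opprD addrACA; apply: coneD; last by case: Lml.
suff /(iso _ _ ul vm)[] : cone_le K (u - l) (v - m) by [].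
split; last exact: orthocomplB.
have -> : v - m - (u - l) = (v - u) - (m - l).
  by apply/rowP => i; rewrite !mxE; ring.
exact: cone_sub_lineality.
Qed.

End LinealitySplitting.

Theorem theorem1 (R : realType) (n : nat) (C : set 'rV[R]_n)
    (hC : closed_convex_cone setT C) :
  let L := lineality C in
  let K := C `&` orthocompl L in
  [/\ orthogonal_sum C K L,
      closed_convex_cone (orthocompl L) K,
      pointed K &
      (isotone_projection_cone setT C <->
       isotone_projection_cone (orthocompl L) K)].
Proof.
split.
- exact: cone_orthogonal_sum.
- exact: orthogonal_part_cone.
- exact: orthogonal_part_pointed.
- exact: isotone_orthogonal_part.
Qed.
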